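(* Let $F$ be a finitely generated free group and let $N \vartriangleleft F$ be a normal subgroup. Then the group $F/N$ is w-sofic if and only if for every finite sequence $g_1, g_2, \dots, g_k$ of elements of $N$ one has $$\overline{[g_1]^F [g_2]^F \cdots [g_k]^F} \subseteq N,$$ where the bar denotes closure in the profinite topology on $F$.
   Context: Notation: for a group $G$, $e_G$ is its unit element; for $g\in G$, $[g]^G$ is the conjugacy class of $g$ in $G$; for $A,B\subseteq G$, $AB=\{xy : x\in A,\ y\in B\}$. Profinite topology: the topology on $F$ in which the normal subgroups of finite index form a base of neighborhoods of the unit element. For $X\subseteq F$, $\overline{X}$ denotes the closure of $X$ in this topology. $(\Phi,\epsilon,\alpha)$-homomorphism: Let $H$ be a finite group with a bi-invariant metric $d$ (i.e. $d(xa,xb)=d(a,b)=d(ax,bx)$ for all $a,b,x\in H$; the metric is not required to be normalized). Let $G$ be a group, $\Phi\subseteq G$ a finite subset, $\epsilon>0$, $\alpha>0$. A map $\phi:\Phi\to H$ is a $(\Phi,\epsilon,\alpha)$-homomorphism if: (1) for any $a,b\in\Phi$ with $ab\in\Phi$, $d(\phi(a)\phi(b),\phi(ab))<\epsilon$; (2) if $e_G\in\Phi$ then $\phi(e_G)=e_H$; (3) for any $a\in\Phi$ with $a\neq e_G$, $d(\phi(a),e_H)>\alpha$. w-sofic: A group $G$ is w-sofic if there exists $\alpha>0$ such that for any finite set $\Phi\subset G$ and any $\epsilon>0$ there exist a finite group $H$ with a bi-invariant metric $d$ and a $(\Phi,\epsilon,\alpha)$-homomorphism from $\Phi$ to $(H,d)$.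 *)

(* Defs.v *)
From HB Require Import structures.
From mathcomp Require Import all_boot all_order all_algebra all_fingroup.
From mathcomp Require Import all_classical reals topology.
Set Implicit Arguments.
Unset Strict Implicit.
Unset Printing Implicit Defensive.

Import Order.TTheory GRing.Theory Num.Theory.
Local Open Scope classical_set_scope.
Local Open Scope quotient_scope.
Local Open Scope group_scope.

Record is_subgroup (G : groupType) (S : set G) : Prop := IsSubgroup {
  sg1 : S 1;
  sgM : forall x y, S x -> S y -> S (x * y);
  sgV : forall x, S x -> S x^-1 }.

Record is_normal_subgroup (G : groupType) (N : set G) : Prop :=
  IsNormalSubgroup {
    nsg_sg : is_subgroup N;
    nsgJ : forall x y, N x -> N (x ^ y) }.

(* The quotient group, for possibly infinite groups: elements are the classes
   of x ~ y <-> x^-1 * y \in N, that is, the left cosets of N. *)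
Section Quotient.
Variables (G : groupType) (N : set G) (nN : is_normal_subgroup N).

Lemma coset_equiv_class : equiv_class_of (fun x y : G => `[< N (x^-1 * y) >]).
Proof.
have sN := nsg_sg nN; split=> [x|x y|y x z].
- by apply/asboolP; rewrite mulVg; apply: sg1.
- by apply/asboolP/asboolP => /(sgV sN); rewrite invgM invgK.
- move=> /asboolP Nxy /asboolP Nyz; apply/asboolP.
  have -> : x^-1 * z = x^-1 * y * (y^-1 * z) by rewrite mulgA mulgK.
  exact: sgM.
Qed.

Definition coset_equiv : equiv_rel G := EquivRelPack coset_equiv_class.

Definition quotg : Type := {eq_quot coset_equiv}.
HB.instance Definition _ := Choice.on quotg.

Definition quotg_proj (x : G) : quotg := \pi_{eq_quot coset_equiv} x.
Definition quotg_repr (a : quotg) : G :=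
  generic_quotient.repr (a : {eq_quot coset_equiv}).

Lemma quotg_reprK : cancel quotg_repr quotg_proj.
Proof. exact: reprK. Qed.

Lemma quotg_projP x y : quotg_proj x = quotg_proj y <-> N (x^-1 * y).
Proof. by split=> [/eqquotP/asboolP|?] //; apply/eqquotP/asboolP. Qed.

Definition quotg_mul (a b : quotg) := quotg_proj (quotg_repr a * quotg_repr b).
Definition quotg_inv (a : quotg) := quotg_proj (quotg_repr a)^-1.

Lemma quotg_projM x y :
  quotg_mul (quotg_proj x) (quotg_proj y) = quotg_proj (x * y).
Proof.
rewrite /quotg_mul; set x' := quotg_repr _; set y' := quotg_repr _.
have Nx : N (x'^-1 * x) by apply/quotg_projP; rewrite quotg_reprK.
have Ny : N (y'^-1 * y) by apply/quotg_projP; rewrite quotg_reprK.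
apply/quotg_projP.
have -> : (x' * y')^-1 * (x * y) = (x'^-1 * x) ^ y' * (y'^-1 * y).
  by rewrite conjgE invgM !mulgA mulgK.
by apply: (sgM (nsg_sg nN)) => //; apply: nsgJ.
Qed.

Lemma quotg_projV x : quotg_inv (quotg_proj x) = quotg_proj x^-1.
Proof.
rewrite /quotg_inv; set x' := quotg_repr _.
have Nx : N (x^-1 * x') by apply/quotg_projP; rewrite quotg_reprK.
apply/quotg_projP; rewrite invgK.
have -> : x' * x^-1 = (x^-1 * x') ^ x^-1.
  by rewrite conjgE invgK !mulgA mulgV mul1g.
exact: nsgJ.
Qed.

Lemma quotg_mulA : associative quotg_mul.
Proof.
move=> a b c; rewrite -(quotg_reprK a) -(quotg_reprK b) -(quotg_reprK c).
by rewrite !quotg_projM mulgA.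
Qed.

Lemma quotg_mul1 : left_id (quotg_proj 1) quotg_mul.
Proof. by move=> a; rewrite -(quotg_reprK a) quotg_projM mul1g. Qed.

Lemma quotg_mulr1 : right_id (quotg_proj 1) quotg_mul.
Proof. by move=> a; rewrite -(quotg_reprK a) quotg_projM mulg1. Qed.

Lemma quotg_mulV : left_inverse (quotg_proj 1) quotg_inv quotg_mul.
Proof.
by move=> a; rewrite -(quotg_reprK a) quotg_projV quotg_projM mulVg.
Qed.

Lemma quotg_mulrV : right_inverse (quotg_proj 1) quotg_inv quotg_mul.
Proof.
by move=> a; rewrite -(quotg_reprK a) quotg_projV quotg_projM mulgV.
Qed.

HB.instance Definition _ := isGroup.Build quotg
  quotg_mulA quotg_mul1 quotg_mulr1 quotg_mulV quotg_mulrV.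

End Quotient.

Section FreeGroup.
Variable F : groupType.

(* F is free on B: every map from B to a group extends uniquely to a
   homomorphism. A map on B is represented by a map f on F of which only the
   values on B matter. *)
Definition free_on (B : set F) : Prop :=
  forall (G : groupType) (f : F -> G),
    (exists h : {multiplicative F -> G}, forall b, B b -> h b = f b) /\
    (forall h1 h2 : {multiplicative F -> G},
       (forall b, B b -> h1 b = h2 b) -> h1 =1 h2).

Definition is_free_group : Prop := exists B : set F, free_on B.

Definition is_finitely_generated : Prop :=
  exists2 A : set F, finite_set A & smallest (@is_subgroup F) A = setT.

End FreeGroup.

Section ProfiniteTopology.
Variable G : groupType.

Definition left_coset (S : set G) (x : G) : set G := [set x * y | y in S].

Definition finite_index (S : set G) : Prop := finite_set (range (left_coset S)).

Lemma is_normal_subgroupT : is_normal_subgroup [set: G].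
Proof. by []. Qed.

Lemma finite_indexT : finite_index [set: G].
Proof.
apply: (@sub_finite_set _ _ [set setT]); last exact: finite_set1.
move=> _ [x _ <-]; apply/seteqP; split=> // y _.
by exists (x^-1 * y) => //; rewrite mulgA mulgV mul1g.
Qed.

Lemma is_normal_subgroupI (K L : set G) :
  is_normal_subgroup K -> is_normal_subgroup L -> is_normal_subgroup (K `&` L).
Proof.
case=> -[K1 KM KV] KJ [[L1 LM LV] LJ].
split; first (split; first by []).
- by move=> x y [? ?] [? ?]; split; [apply: KM|apply: LM].
- by move=> x [? ?]; split; [apply: KV|apply: LV].
- by move=> x y [? ?]; split; [apply: KJ|apply: LJ].
Qed.

Lemma finite_indexI (K L : set G) :
  finite_index K -> finite_index L -> finite_index (K `&` L).
Proof.
move=> fK fL; apply: sub_finite_set (finite_image2 (@setI G) fK fL).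
move=> _ [x _ <-]; exists (left_coset K x); first by exists x.
exists (left_coset L x); first by exists x.
apply/seteqP; split=> [y [[k Kk <-] [l Ll /mulgI kl]]|y [k [Kk Lk] <-]].
  by exists k => //; split => //; rewrite -kl.
by split; exists k.
Qed.

(* A copy of G carrying the profinite topology: the neighborhoods of x are the
   sets containing x * K for some normal subgroup K of finite index. *)
Definition profinite : Type := G.
HB.instance Definition _ := Group.on profinite.

Definition profinite_nbhs (x : profinite) : set_system profinite :=
  [set A | exists K : set G,
     [/\ is_normal_subgroup K, finite_index K & left_coset K x `<=` A]].

HB.instance Definition _ := hasNbhs.Build profinite profinite_nbhs.

Lemma profinite_nbhs_filter (x : profinite) : ProperFilter (nbhs x).
Proof.
apply: Build_ProperFilter_ex.
  move=> A [K [nK _ KA]]; exists x; apply: KA; exists 1; last exact: mulg1.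
  exact: sg1 (nsg_sg nK).
split.
- by exists setT; split=> //; apply: finite_indexT.
- move=> A B [K [nK fK KA]] [L [nL fL LB]]; exists (K `&` L); split.
  + exact: is_normal_subgroupI.
  + exact: finite_indexI.
  + by move=> _ [k [Kk Lk] <-]; split; [apply: KA|apply: LB]; exists k.
- move=> A B AB [K [nK fK KA]]; exists K; split=> //.
  exact: subset_trans KA AB.
Qed.

Lemma profinite_nbhs_singleton (x : profinite) (A : set profinite) :
  nbhs x A -> A x.
Proof.
move=> [K [nK _ KA]]; apply: KA; exists 1; last exact: mulg1.
exact: sg1 (nsg_sg nK).
Qed.

Lemma profinite_nbhs_nbhs (x : profinite) (A : set profinite) :
  nbhs x A -> nbhs x (nbhs^~ A).
Proof.
move=> [K [nK fK KA]]; exists K; split=> // _ [k Kk <-].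
exists K; split=> // _ [l Kl <-]; apply: KA.
by exists (k * l); [apply: sgM (nsg_sg nK) _ _ Kk Kl|rewrite mulgA].
Qed.

HB.instance Definition _ := Nbhs_isNbhsTopological.Build profinite
  profinite_nbhs_filter profinite_nbhs_singleton profinite_nbhs_nbhs.

Definition profinite_closure (X : set G) : set G :=
  @closure profinite X.

End ProfiniteTopology.

Section ConjugacyClasses.
Variable G : groupType.

Definition conj_class (g : G) : set G := range (fun x => g ^ x).

Definition prod_set (A B : set G) : set G := [set x * y | x in A & y in B].

(* [g_1]^G ... [g_k]^G for s = [:: g_1; ...; g_k] *)
Definition conj_class_prod (s : seq G) : set G :=
  foldr (fun g A => prod_set (conj_class g) A) [set 1] s.

End ConjugacyClasses.

Section WSofic.
Variable R : realType.
Local Open Scope ring_scope.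

Record is_metric (T : Type) (d : T -> T -> R) : Prop := IsMetric {
  metric_ge0 : forall x y, 0 <= d x y;
  metric_eq0 : forall x y, d x y = 0 <-> x = y;
  metric_sym : forall x y, d x y = d y x;
  metric_triangle : forall x y z, d x z <= d x y + d y z }.

Definition biinvariant (H : groupType) (d : H -> H -> R) : Prop :=
  forall a b x : H,
    d (x * a)%g (x * b)%g = d a b /\ d (a * x)%g (b * x)%g = d a b.

(* (Phi, eps, alpha)-homomorphisms; phi : Phi -> H is represented by a total
   map of which only the values on Phi matter. *)
Record approx_hom (G H : groupType) (d : H -> H -> R) (Phi : set G)
    (eps alpha : R) (phi : G -> H) : Prop := ApproxHom {
  approx_homM : forall a b, Phi a -> Phi b -> Phi (a * b)%g ->
    d (phi a * phi b)%g (phi (a * b)%g) < eps;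
  approx_hom1 : Phi 1%g -> phi 1%g = 1%g;
  approx_hom_gt : forall a, Phi a -> a <> 1%g -> alpha < d (phi a) 1%g }.

Definition w_sofic (G : groupType) : Prop :=
  exists2 alpha : R, 0 < alpha &
    forall (Phi : set G) (eps : R), finite_set Phi -> 0 < eps ->
      exists (H : finGroupType) (d : H -> H -> R) (phi : G -> H),
        [/\ is_metric d, biinvariant d & approx_hom d Phi eps alpha phi].

End WSofic.

(* Main.v *)
Require Import Defs.
From HB Require Import structures.
From mathcomp Require Import all_boot all_order all_algebra all_fingroup.
From mathcomp Require Import all_classical reals topology.
From mathcomp Require Import lra.
Local Open Scope classical_set_scope.

Set Implicit Arguments.
Unset Strict Implicit.
Unset Printing Implicit Defensive.
Import Order.TTheory GRing.Theory Num.Theory.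

(** Write p for the projection of F onto F/N, and let B be a basis of F.

    Necessity. Suppose that F/N is w-sofic with constant alpha, that the g_i
    lie in N, and that w is in the closure of [g_1]...[g_k] but not in N. Take
    a (Phi, eps, alpha)-homomorphism phi from F/N to a finite group H, and let
    psi : F -> H be the homomorphism that agrees with phi o p on B. For each
    fixed x, the distance from psi x to phi (p x) is at most n eps, where n
    depends only on x, as soon as Phi contains a finite set depending only on
    x (tracked_all). As p maps g_i to 1, the element psi g_i is close to 1, and
    then so is psi y for every y in [g_1]...[g_k], because a bi-invariant
    metric is subadditive along products and invariant under conjugation
    (conj_class_prod_small). But psi w is more than alpha away from 1, up to a
    multiple of eps, while psi w = psi y for some such y, because ker psi has
    finite index (profinite_closure_image). A small eps is contradictory.

    Sufficiency. Given a finite Phi and eps, choose representatives r a of the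
    elements of F/N. The defects r a * r b * (r (a b))^-1, for a and b in Phi,
    lie in N. Let s list the defects and their inverses, and let M exceed
    2/eps. By hypothesis, for a <> 1 in Phi, r a is outside the closure of every
    product of at most M conjugacy classes of elements of s; there are finitely
    many such products, so one normal subgroup K of finite index separates all
    of them from all of these r a. In H = F/K measure an element by the least
    number, cut off at M, of conjugates of images of elements of s of which it
    is a product, scaled by eps/2. This is a conjugation invariant length, so
    it gives a bi-invariant metric (cut_dist_metric, cut_dist_biinvariant). The
    defects get length at most eps/2, and r a gets the full length M eps/2 > 1
    for every a <> 1 in Phi. Taking M as large as this is possible because the
    metric need not be normalized. Hence a |-> r a K is a
    (Phi, eps, 1)-homomorphism. *)

(** * Homomorphisms of groups *)

Section GroupHomomorphisms.
Variables (G H : groupType) (f : {multiplicative G -> H}).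
Local Open Scope group_scope.

Lemma hom1 : f 1 = 1.
Proof. by apply: (mulgI (f 1)); rewrite -gmulfM !mulg1. Qed.

Lemma homV : {morph f : x / x^-1}.
Proof. by move=> x; apply: (mulgI (f x)); rewrite -gmulfM !mulgV hom1. Qed.

Lemma homF : {morph f : x y / x * y^-1}.
Proof. by move=> x y; rewrite gmulfM homV. Qed.

Lemma homJ : {morph f : x y / x ^ y}.
Proof. by move=> x y; rewrite !conjgE !gmulfM homV. Qed.

End GroupHomomorphisms.

(** * A free group is generated by its basis *)

Section Generation.
Variable F : groupType.
Local Open Scope group_scope.

Section SubgroupType.
Variables (S : set F) (sS : is_subgroup S).

Let inS : pred F := fun x => `[< S x >].

Lemma subgroup_closed : group_closed inS.
Proof.
split; first by apply/asboolP; apply: sg1 sS.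
move=> x y /asboolP Sx /asboolP Sy; apply/asboolP.
by apply: sgM => //; apply: sgV.
Qed.

(** The proof that S is a subgroup is an argument so that the group structure
    can be attached to the type. *)
Definition subgroup_type of is_subgroup S : Type := {x : F | inS x}.
HB.instance Definition _ := SubChoice.on (subgroup_type sS).
HB.instance Definition _ :=
  SubChoice_isSubGroup.Build F inS (subgroup_type sS) subgroup_closed.

Definition subgroup_incl : {multiplicative subgroup_type sS -> F} :=
  (val : subgroup_type sS -> F).

Lemma subgroup_inclP (x : subgroup_type sS) : S (subgroup_incl x).
Proof. exact: asboolW (valP x). Qed.

End SubgroupType.

(** Free groups are generated by their bases: the inclusion of B into the
    subgroup S extends to a homomorphism F -> S; composed with the inclusion of
    S it agrees with the identity on B, hence is the identity. *)
Lemma free_on_ind (B S : set F) :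
  free_on B -> is_subgroup S -> B `<=` S -> forall x, S x.
Proof.
move=> freeB sS BS x.
(* The value 1 outside S is arbitrary: B is contained in S. *)
pose f (y : F) : subgroup_type sS := insubd (1 : subgroup_type sS) y.
have [[h hB] _] := freeB _ f.
have [_ /(_ (subgroup_incl sS \o h) idfun) uniq_id] := freeB F id.
have <- : subgroup_incl sS (h x) = x.
  apply: (uniq_id _ x) => b Bb /=.
  by rewrite hB // /f /= val_insubd; case: asboolP => // /(_ (BS _ Bb)).
exact: subgroup_inclP.
Qed.

End Generation.

(** * The quotient by a normal subgroup of finite index *)

Section FiniteQuotient.
Variables (G : groupType) (K : set G) (nK : is_normal_subgroup K).
Local Open Scope group_scope.

Lemma quotg_proj_multiplicative : {morph quotg_proj nK : x y / x * y}.
Proof. by move=> x y; rewrite -quotg_projM. Qed.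
HB.instance Definition _ :=
  isMultiplicative.Build G (quotg nK) (quotg_proj nK) quotg_proj_multiplicative.

Lemma quotg_proj1 : quotg_proj nK 1 = 1.
Proof. by []. Qed.

Lemma quotg_proj_eq1 x : quotg_proj nK x = 1 <-> K x.
Proof.
rewrite -quotg_proj1; split=> [/esym|Kx].
  by move/quotg_projP; rewrite invg1 mul1g.
by apply/esym/quotg_projP; rewrite invg1 mul1g.
Qed.

Hypothesis fK : finite_index K.

Lemma finite_quotg : finite_set [set: quotg nK].
Proof.
apply: sub_finite_set (finite_image
  (fun A : set G => quotg_proj nK (xget 1 A)) fK) => a _.
exists (left_coset K (quotg_repr a)); first by exists (quotg_repr a).
rewrite -[RHS]quotg_reprK; apply/esym/quotg_projP.
have : left_coset K (quotg_repr a) (quotg_repr a).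
  by exists 1; [apply: sg1 (nsg_sg nK)|rewrite mulg1].
by move=> /(xgetI 1)[k Kk <-]; rewrite mulKg.
Qed.

(** The proof of finite index is an argument so that the finite type structure
    can be attached to the type. *)
Definition finquotg of finite_index K : Type := quotg nK.
HB.instance Definition _ := Group.on (finquotg fK).

Definition finquotg_enum : seq (finquotg fK) :=
  undup (sval (cid ((@finite_seqP (quotg nK) _).1 finite_quotg))).

Lemma mem_finquotg_enum a : a \in finquotg_enum.
Proof.
rewrite /finquotg_enum mem_undup; case: cid => s /= sT.
by have /= <- : [set: quotg nK] a = (a \in s) by rewrite sT.
Qed.

Lemma index_finquotg_enumK :
  pcancel (fun a : finquotg fK => index a finquotg_enum) (onth finquotg_enum).
Proof.
by move=> a; rewrite onthE (nth_map 1) ?nth_index ?index_mem ?mem_finquotg_enum.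
Qed.
HB.instance Definition _ := PCanIsCountable index_finquotg_enumK.

Lemma finquotg_enumP : Finite.axiom finquotg_enum.
Proof.
by move=> a; rewrite count_uniq_mem ?undup_uniq // mem_finquotg_enum.
Qed.
HB.instance Definition _ := isFinite.Build (finquotg fK) finquotg_enumP.

Lemma finite_quotient_exists : exists (H : finGroupType)
    (f : {multiplicative G -> H}),
  (forall h, exists x, f x = h) /\ (forall x, f x = 1 <-> K x).
Proof.
exists (finquotg fK : finGroupType), (quotg_proj nK).
split=> [h|]; last exact: quotg_proj_eq1.
by exists (quotg_repr (h : quotg nK)); exact: quotg_reprK.
Qed.

End FiniteQuotient.

(** * Bi-invariant metrics *)

Section BiinvariantMetric.
Variables (R : realType) (H : groupType) (d : H -> H -> R).
Hypotheses (md : is_metric d) (bd : biinvariant d).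
Local Open Scope ring_scope.

Lemma dist_refl x : d x x = 0.
Proof. exact/(metric_eq0 md). Qed.

Lemma distM a b a' b' : d (a * b)%g (a' * b')%g <= d a a' + d b b'.
Proof.
apply: le_trans (Defs.metric_triangle md _ (a' * b)%g _) _.
by rewrite (bd _ _ _).1 (bd _ _ _).2.
Qed.

Lemma distJ1 a x : d (a ^ x)%g 1%g = d a 1%g.
Proof.
by rewrite -[RHS](bd _ _ x).2 mul1g -[RHS](bd _ _ x^-1%g).1 mulVg conjgE mulgA.
Qed.

End BiinvariantMetric.

(** * Approximate homomorphisms of F/N against homomorphisms of F *)

Section Tracking.
Variables (R : realType) (F : groupType) (N : set F).
Hypothesis nN : is_normal_subgroup N.
Variables (B : set F) (alpha : R).
Local Open Scope ring_scope.
Let p := quotg_proj nN.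

(** The set Phi and the number n may depend on x, but not on the target group,
    the metric, the maps or eps. Quantifying over all Psi that contain Phi makes
    it possible to combine finitely many such bounds. *)
Definition tracked (x : F) : Prop :=
  exists (Phi : set (quotg nN)) (n : nat), finite_set Phi /\
    forall (Psi : set (quotg nN)) (eps : R) (H : groupType) (d : H -> H -> R)
        (phi : quotg nN -> H) (psi : {multiplicative F -> H}),
      is_metric d -> biinvariant d -> approx_hom d Psi eps alpha phi ->
      Phi `<=` Psi -> (forall b, B b -> psi b = phi (p b)) ->
      d (psi x) (phi (p x)) <= n%:R * eps.

(** The error terms add up: a product costs one more eps for the approximate
    multiplicativity of phi, and an inverse x^-1 is handled through the
    product of phi (p x) and phi (p x^-1), which is within eps of 1. *)
Lemma tracked_subgroup : is_subgroup tracked.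
Proof.
split.
- exists [set 1%g], 0%N; split=> // Psi eps H d phi psi md _ hphi sub _.
  rewrite hom1 /p quotg_proj1 (approx_hom1 hphi) ?dist_refl ?mul0r //.
  exact: sub.
- move=> x y [P [m [fP Hx]]] [Q [n [fQ Hy]]].
  exists (P `|` Q `|` ([set p x; p y] `|` [set p (x * y)%g])), (m + n).+1.
  split; first by rewrite !finite_setU; do !split.
  move=> Psi eps H d phi psi md bd hphi sub psiB.
  have {}Hx := Hx Psi eps H d phi psi md bd hphi _ psiB.
  have {}Hy := Hy Psi eps H d phi psi md bd hphi _ psiB.
  have {}Hx : d (psi x) (phi (p x)) <= m%:R * eps.
    by apply: Hx => a Pa; apply: sub; left; left.
  have {}Hy : d (psi y) (phi (p y)) <= n%:R * eps.
    by apply: Hy => a Pa; apply: sub; left; right.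
  have Exy : p (x * y)%g = (p x * p y)%g by rewrite /p gmulfM.
  have Hxy : d (phi (p x) * phi (p y))%g (phi (p (x * y)%g)) < eps.
    rewrite Exy; apply: (approx_homM hphi); rewrite -?Exy.
    + by apply: sub; right; left; left.
    + by apply: sub; right; left; right.
    + by apply: sub; right; right.
  rewrite gmulfM.
  have := Defs.metric_triangle md (psi x * psi y)%g (phi (p x) * phi (p y))%g
    (phi (p (x * y)%g)).
  have := distM md bd (psi x) (psi y) (phi (p x)) (phi (p y)).
  rewrite -natr1 natrD !mulrDl mul1r; lra.
- move=> x [P [n [fP Hx]]].
  exists (P `|` ([set p x; p x^-1%g] `|` [set 1%g])), n.+1.
  split; first by rewrite !finite_setU; do !split.
  move=> Psi eps H d phi psi md bd hphi sub psiB.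
  have {}Hx : d (psi x) (phi (p x)) <= n%:R * eps.
    by apply: (Hx _ _ _ _ _ _ md bd hphi _ psiB) => // a Pa; apply: sub; left.
  have E1 : (p x * p x^-1)%g = 1%g by rewrite -gmulfM mulgV.
  have P1 : Psi 1%g by apply: sub; right; right.
  have HV : d (phi (p x) * phi (p x^-1))%g (phi (p x * p x^-1))%g < eps.
    apply: (approx_homM hphi); rewrite ?E1 //.
    + by apply: sub; right; left; left.
    + by apply: sub; right; left; right.
  move: HV; rewrite E1 (approx_hom1 hphi) // => HV.
  have -> : d (psi x^-1%g) (phi (p x^-1%g)) = d 1%g (psi x * phi (p x^-1))%g.
    by rewrite -(bd _ _ (psi x)).1 homV mulgV.
  have := Defs.metric_triangle md 1%g (phi (p x) * phi (p x^-1))%g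
     (psi x * phi (p x^-1))%g.
  rewrite (bd _ _ _).2 (Defs.metric_sym md _ (phi _ * _)%g).
  rewrite (Defs.metric_sym md _ (psi x)).
  rewrite -natr1 mulrDl mul1r; lra.
Qed.

Lemma tracked_all : free_on B -> forall x, tracked x.
Proof.
move=> freeB; apply: (free_on_ind freeB tracked_subgroup) => b Bb.
exists set0, 0%N; split=> // Psi eps H d phi psi md _ _ _ psiB.
by rewrite psiB // dist_refl // mul0r.
Qed.

(** For g in N, p g = 1, so psi g is within a multiple of eps of phi 1 = 1.
    Conjugating does not change the distance to 1, and this is why the bound is
    uniform over the whole, possibly infinite, product of classes. *)
Lemma conj_class_prod_small (s : seq F) :
  free_on B -> (forall g, g \in s -> N g) ->
  exists (Phi : set (quotg nN)) (n : nat), finite_set Phi /\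
    forall (Psi : set (quotg nN)) (eps : R) (H : groupType) (d : H -> H -> R)
        (phi : quotg nN -> H) (psi : {multiplicative F -> H}),
      is_metric d -> biinvariant d -> approx_hom d Psi eps alpha phi ->
      Phi `<=` Psi -> (forall b, B b -> psi b = phi (p b)) ->
      forall y, conj_class_prod s y -> d (psi y) 1%g <= n%:R * eps.
Proof.
move=> freeB; elim: s => [|g s IHs] Ns.
  exists set0, 0%N; split=> // Psi eps H d phi psi md _ _ _ _ _ ->.
  by rewrite hom1 dist_refl ?mul0r.
have [|P [m [fP HP]]] := IHs.
  by move=> h hs; apply: Ns; rewrite inE hs orbT.
have [Q [n [fQ HQ]]] := tracked_all freeB g.
exists (P `|` Q `|` [set 1%g]), (n + m)%N.
split; first by rewrite !finite_setU; do !split.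
move=> Psi eps H d phi psi md bd hphi sub psiB _ [_ [x _ <-] [y sy <-]].
have pg : p g = 1%g by apply/quotg_proj_eq1/Ns; rewrite inE eqxx.
have P1 : Psi 1%g by apply: sub; right.
have Hg : d (psi g) (phi (p g)) <= n%:R * eps.
  by apply: (HQ _ _ _ _ _ _ md bd hphi _ psiB) => // a Qa; apply: sub; left; right.
rewrite pg (approx_hom1 hphi) // in Hg.
have Hy : d (psi y) 1%g <= m%:R * eps.
  apply: (HP _ _ _ _ _ _ md bd hphi _ psiB _ sy) => // a Pa.
  by apply: sub; left; left.
have := distM md bd (psi g ^ psi x)%g (psi y) 1%g 1%g.
rewrite gmulfM homJ mulg1 (distJ1 bd) natrD mulrDl; lra.
Qed.

End Tracking.

(** * The profinite closure seen in finite quotients *)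

Section ClosureFiniteImage.
Variables (G : groupType).
Local Open Scope group_scope.

(** The kernel K of f is normal of finite index, so w K is a neighborhood of w
    and meets X. *)
Lemma profinite_closure_image (H : finGroupType) (f : {multiplicative G -> H})
    (X : set G) (w : G) :
  profinite_closure X w -> exists2 y, X y & f y = f w.
Proof.
pose K := [set x | f x = 1].
have nK : is_normal_subgroup K.
  split; first split; rewrite /K /=.
  - exact: hom1.
  - by move=> x y /= fx fy; rewrite gmulfM fx fy mulg1.
  - by move=> x /= fx; rewrite homV fx invg1.
  - by move=> x y /= fx; rewrite homJ fx conj1g.
have fK : finite_index K.
  apply: sub_finite_set (finite_image (fun h => [set x | f x = h])
    (finite_finpred xpredT)) => _ [x _ <-].
  exists (f x) => //; apply/seteqP; split=> [y /= fy|_ [k /= fk <-]].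
    by exists (x^-1 * y); rewrite ?mulKVg // /K /= gmulfM homV fy mulVg.
  by rewrite gmulfM fk mulg1.
move=> /(_ (left_coset K w)) []; first by exists K; split.
by move=> y [Xy [k /= fk yE]]; exists y; rewrite // -yE gmulfM fk mulg1.
Qed.

(** Translating to a neighborhood of 1 lets finitely many such conditions, at
    different points w, be met by the same normal subgroup. *)
Lemma notin_profinite_closure (X : set G) (w : G) :
  ~ profinite_closure X w ->
  nbhs (1 : profinite G) [set k | ~ X (w * k)].
Proof.
move=> /existsNP[A /not_implyP[[K [nK fK KA]] XA]].
exists K; split=> // _ [k Kk <-] /=; rewrite mul1g => Xwk.
by apply: XA; exists (w * k); split=> //; apply: KA; exists k.
Qed.

End ClosureFiniteImage.

(** * The metric of a truncated word length *)

Section WordLength.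
Variables (H : finGroupType) (T : {set H}) (M : nat).
Local Open Scope group_scope.

(** The least n such that h is a product of n elements of T, cut off at M: [find]
    returns the length M of the list when no n below M works. *)
Definition cut_length (h : H) : nat := find (fun n => h \in T ^+ n) (iota 0 M).

Lemma cut_length_max h : (cut_length h <= M)%N.
Proof. by rewrite -[leqRHS](size_iota 0) find_size. Qed.

Lemma cut_length_le h n : h \in T ^+ n -> (cut_length h <= n)%N.
Proof.
move=> hTn; case: (ltnP n M) => [ltnM|].
  rewrite leqNgt; apply/negP => /(before_find 0).
  by rewrite nth_iota // add0n hTn.
exact: leq_trans (cut_length_max h).
Qed.

Lemma cut_length_mem h : (cut_length h < M)%N -> h \in T ^+ cut_length h.
Proof.
move=> lthM; have := lthM; rewrite -[X in (_ < X)%N](size_iota 0) -has_find.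
by move/(nth_find 0); rewrite nth_iota.
Qed.

Lemma cut_length1 : cut_length 1 = 0%N.
Proof. by apply/eqP; rewrite -leqn0 cut_length_le // expg0 set11. Qed.

Lemma cut_length_eq0 h : (0 < M)%N -> cut_length h = 0%N -> h = 1.
Proof.
by move=> M0 h0; have := @cut_length_mem h; rewrite h0 expg0 => /(_ M0)/set1P.
Qed.

(** Concatenate two words; if one of the lengths is the cut-off M, the bound is
    trivial. *)
Lemma cut_lengthM x y : (cut_length (x * y) <= cut_length x + cut_length y)%N.
Proof.
have [ltxM|lexM] := ltnP (cut_length x) M; last first.
  exact: leq_trans (cut_length_max _) (leq_trans lexM (leq_addr _ _)).
have [ltyM|leyM] := ltnP (cut_length y) M; last first.
  exact: leq_trans (cut_length_max _) (leq_trans leyM (leq_addl _ _)).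
by apply: cut_length_le; rewrite expgnDr mem_mulg // cut_length_mem.
Qed.

Hypothesis TV : T^-1 = T.
Hypothesis TJ : forall x, T :^ x = T.

Lemma cut_lengthV x : cut_length x^-1 = cut_length x.
Proof.
by apply: eq_find => n; rewrite -mem_invg -expVgn TV.
Qed.

Lemma cut_lengthJ x y : cut_length (x ^ y) = cut_length x.
Proof.
have TnJ n : (T ^+ n) :^ y = T ^+ n.
  by elim: n => [|n IHn]; rewrite ?expg0 ?conjs1g // !expgS conjsMg TJ IHn.
by apply: eq_find => n; rewrite -{1}(TnJ n) memJ_conjg.
Qed.

Section CutMetric.
Variables (R : realType) (delta : R).
Hypotheses (delta0 : (0 < delta)%R) (M0 : (0 < M)%N).
Local Open Scope ring_scope.

Definition cut_dist (x y : H) : R := delta * (cut_length (x * y^-1)%g)%:R.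

Lemma cut_dist_metric : is_metric cut_dist.
Proof.
split.
- by move=> x y; rewrite mulr_ge0 ?ler0n // ltW.
- move=> x y; split=> [/eqP|->]; last first.
    by rewrite /cut_dist mulgV cut_length1 mulr0.
  rewrite mulf_eq0 gt_eqF //= pnatr_eq0 => /eqP/(cut_length_eq0 M0).
  exact: divg1_eq.
- by move=> x y; rewrite /cut_dist -cut_lengthV invgF.
- move=> x y z; rewrite -mulrDr -natrD ler_pM2l // ler_nat.
  by have := cut_lengthM (x * y^-1)%g (y * z^-1)%g; rewrite mulgA mulgVK.
Qed.

Lemma cut_dist_biinvariant : biinvariant cut_dist.
Proof.
move=> a b x; rewrite /cut_dist mulgKA; split=> //.
by rewrite -(cut_lengthJ (a * b^-1)%g x^-1%g) conjgE invgK invgM !mulgA.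
Qed.

End CutMetric.

End WordLength.

(** * Lifting products of conjugates *)

Section ConjugateLifting.
Variables (G : groupType) (H : finGroupType) (f : {multiplicative G -> H}).
Hypothesis f_surj : forall h, exists x, f x = h.
Variable s : seq G.
Local Open Scope group_scope.

Definition conj_image : {set H} :=
  class_support [set x in [seq f g | g <- s]]%SET [set: H]%SET.

Lemma mem_conj_image g : g \in s -> f g \in conj_image.
Proof. by move=> gs; rewrite mem_class_support // inE map_f. Qed.

Lemma conj_imageJ x : conj_image :^ x = conj_image.
Proof. by rewrite (@class_supportGidr H [set: H]%G) ?finset.in_setT. Qed.

Lemma conj_imageV :
  (forall g, g \in s -> g^-1 \in s) -> conj_image^-1 = conj_image.
Proof.
move=> sV; have sub h : h \in conj_image -> h^-1 \in conj_image.
  move=> /imset2P[z y + _ ->]; rewrite inE => /mapP[g gs ->].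
  by rewrite -conjVg memJ_class_support ?inE // -homV map_f // sV.
apply/setP => h; rewrite mem_invg; apply/idP/idP => /sub //.
by rewrite invgK.
Qed.

(** As f is onto, the conjugating elements of H lift to G. This turns lengths in
    H into membership in products of conjugacy classes of G. *)
Lemma conj_image_expP n h : h \in conj_image ^+ n ->
  exists l : seq G, [/\ size l = n, {subset l <= s} &
    exists2 y, conj_class_prod l y & f y = h].
Proof.
elim: n h => [|n IHn] h.
  by rewrite expg0 => /set1P ->; exists [::]; split=> //; exists 1; rewrite ?hom1.
rewrite expgS => /mulsgP[a h' /imset2P[b z + _ ->] /IHn[l [<- ls [y ly <-]]] ->].
rewrite inE => /mapP[g gs ->]; have [x <-] := f_surj z.
exists (g :: l); split=> //.
  by move=> c; rewrite inE => /predU1P[->|/ls].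
exists (g ^ x * y); first by exists (g ^ x); [exists x|exists y].
by rewrite gmulfM homJ.
Qed.

End ConjugateLifting.

(** * The two implications *)

Section MainTheorem.
Variables (R : realType) (F : groupType) (N : set F).
Hypothesis nN : is_normal_subgroup N.
Local Open Scope ring_scope.

Lemma w_sofic_closure :
  is_free_group F -> w_sofic R (quotg nN) ->
  forall s : seq F, (forall g, g \in s -> N g) ->
    profinite_closure (conj_class_prod s) `<=` N.
Proof.
move=> [B freeB] [alpha alpha0 sofic] s Ns w clw.
apply: contrapT => Nw; pose p := quotg_proj nN.
have [P [m [fP HP]]] := conj_class_prod_small nN alpha freeB Ns.
have [Q [n [fQ HQ]]] := tracked_all nN alpha freeB w.
pose Psi := P `|` Q `|` [set p w].
(* The two errors m eps and n eps together stay below alpha. *)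
pose eps := alpha / (m + n).+1%:R.
have eps0 : 0 < eps by rewrite divr_gt0 ?ltr0n.
have fPsi : finite_set Psi by rewrite !finite_setU; do !split.
have [H [d [phi [md bd hphi]]]] := sofic Psi eps fPsi eps0.
have [[psi psiB] _] := freeB H (phi \o p).
have [y sy psiy] := profinite_closure_image psi clw.
have Hy : d (psi y) 1%g <= m%:R * eps.
  by apply: (HP _ _ _ _ _ _ md bd hphi _ psiB _ sy) => // a Pa; left; left.
have Hw : d (psi w) (phi (p w)) <= n%:R * eps.
  by apply: (HQ _ _ _ _ _ _ md bd hphi _ psiB) => // a Qa; left; right.
have pw : p w <> 1%g by move/quotg_proj_eq1.
have far : alpha < d (phi (p w)) 1%g by apply: (approx_hom_gt hphi) => //; right.
have := Defs.metric_triangle md (phi (p w)) (psi w) 1%g.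
rewrite (Defs.metric_sym md _ (psi w)) -{2}psiy => tri.
have : alpha = (m + n).+1%:R * eps by rewrite mulrC divfK // pnatr_eq0.
rewrite -natr1 natrD !mulrDl mul1r; lra.
Qed.

Lemma closure_w_sofic :
  (forall s : seq F, (forall g, g \in s -> N g) ->
    profinite_closure (conj_class_prod s) `<=` N) ->
  w_sofic R (quotg nN).
Proof.
move=> clN; exists 1 => // Phi eps /finite_seqP[p ->] eps0.
(* Representatives with r 1 = 1, so that the final map sends 1 to 1. *)
pose r (a : quotg nN) : F := if a == 1%g then 1%g else quotg_repr a.
have rK a : quotg_proj nN (r a) = a.
  by rewrite /r; case: eqP => [->|_]; rewrite ?quotg_reprK.
pose defects := [seq (r a * r b * (r (a * b))^-1)%g | a <- p, b <- p].
pose s := defects ++ [seq g^-1%g | g <- defects].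
pose ws := [seq r a | a <- p & a != 1%g].
have Ndef g : g \in defects -> N g.
  case/allpairsP=> -[a b] /= [_ _ ->]; apply/(quotg_proj_eq1 nN).
  by rewrite homF gmulfM /= !rK mulgV.
have Ns g : g \in s -> N g.
  rewrite mem_cat => /orP[/Ndef //|/mapP[h /Ndef Nh ->]].
  exact: sgV (nsg_sg nN) _ Nh.
have sV g : g \in s -> g^-1%g \in s.
  rewrite !mem_cat => /orP[gd|/mapP[h hd ->]]; last by rewrite invgK hd.
  by rewrite map_f ?orbT.
have Nws w : w \in ws -> ~ N w.
  case/mapP=> a; rewrite mem_filter => /andP[a1 _] -> /(quotg_proj_eq1 nN).
  by rewrite rK; apply/eqP.
pose delta := eps / 2; have delta0 : 0 < delta by rewrite divr_gt0.
pose M := Num.bound delta^-1.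
have deltaM : 1 < delta * M%:R.
  by rewrite mulrC -ltr_pdivrMr // div1r archi_boundP // invr_ge0 ltW.
have M0 : (0 < M)%N.
  by rewrite lt0n; apply: contraTneq deltaM => ->; rewrite mulr0 ltr10.
(* A single K separates each r a from the products over all words in s of
   length at most M: the words and the elements r a form a finite type. *)
have [K [nK fK KX]] : nbhs (1%g : profinite F) [set k |
    forall i : M.-bseq (seq_sub s) * seq_sub ws,
      ~ conj_class_prod [seq ssval x | x <- i.1] (ssval i.2 * k)%g].
  apply: (filter_forall (nbhs_filter (1%g : profinite F))).
  move=> -[l w]; apply: notin_profinite_closure => /=.
  move/clN=> Nw; apply: (Nws (ssval w)); first exact: valP.
  by apply: Nw => g /mapP[x _ ->]; apply: Ns; exact: valP.
have [H [f [f_surj f_ker]]] := finite_quotient_exists nK fK.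
pose T := conj_image f s.
have TV : (T^-1)%g = T by apply: conj_imageV.
have TJ x : (T :^ x)%g = T by apply: conj_imageJ.
exists H, (cut_dist T M delta), (f \o r); split.
- exact: cut_dist_metric.
- exact: cut_dist_biinvariant.
split=> /=.
- move=> a b pa pb pab; rewrite /cut_dist -gmulfM -homF.
  have /(@cut_length_le _ _ M _ 1%N) le1 : f (r a * r b * (r (a * b))^-1)%g \in T.
    apply: mem_conj_image; rewrite mem_cat; apply/orP; left.
    exact: (allpairs_f (fun a b => r a * r b * (r (a * b))^-1)%g).
  apply: (@le_lt_trans _ _ delta); last by rewrite /delta; lra.
  by rewrite ger_pMr // lern1.
- by rewrite /r eqxx hom1.
- move=> a pa a1; rewrite /cut_dist divg1.
  suff -> : cut_length T M (f (r a)) = M by [].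
  (* A shorter expression of f (r a) would lift to an element y of a product of
     classes with y in (r a) K, against the choice of K. *)
  apply/eqP; rewrite eqn_leq cut_length_max leqNgt; apply/negP => ltM.
  have [l [lsz ls [y ly fy]]] := conj_image_expP f_surj (cut_length_mem ltM).
  have ra : r a \in ws.
    by rewrite map_f // mem_filter; apply/andP; split=> //; apply/eqP.
  pose l' : seq (seq_sub s) := pmap insub l.
  have l'E : [seq ssval x | x <- l'] = l.
    rewrite /l' (pmap_filter (insubK _)); apply/all_filterP/allP => g gl.
    by rewrite isSome_insub ls.
  have l'sz : (size l' <= M)%N.
    by rewrite -(size_map (@ssval _ s)) l'E lsz ltnW.
  apply: (KX ((r a)^-1 * y)%g _ (Bseq l'sz, SeqSub ra)) => /=.
    exists ((r a)^-1 * y)%g; last by rewrite mul1g.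
    by apply/f_ker; rewrite gmulfM homV fy mulVg.
  by rewrite l'E mulKVg.
Qed.

End MainTheorem.

Theorem theorem4p3 (R : realType) (F : groupType) (N : set F)
    (freeF : is_free_group F) (fgF : is_finitely_generated F)
    (nN : is_normal_subgroup N) :
  w_sofic R (quotg nN) <->
  (forall s : seq F, (forall g, g \in s -> N g) ->
     profinite_closure (conj_class_prod s) `<=` N).
Proof. by split; [exact: w_sofic_closure|exact: closure_w_sofic]. Qed.
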